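(* Let $F:\mathsf{Comp}\to\mathsf{Comp}$ be a functional functor preserving singletons (i.e. $F$ maps one-point spaces to one-point spaces). For a compact Hausdorff space $X$: (1) $X$ is $F$-Dugundji if and only if $X$ is an absolute $F$-valued retract; (2) $X$ is $F$-Milutin if $X$ is absolute $F$-Milutin. Moreover, if the functional functor $F$ preserves preimages over points, then a compact Hausdorff space $X$ is $F$-Milutin if and only if $X$ is absolute $F$-Milutin.
   Context: $\mathsf{Comp}$ is the category of compact Hausdorff spaces and continuous maps. For a compact Hausdorff space $X$, $C(X)$ is the space of continuous real-valued functions on $X$ and $\mathbb R^{C(X)}$ is the space of all (arbitrary) functions $\mu:C(X)\to\mathbb R$ with the Tychonoff product topology. A continuous map $f:X\to Y$ induces $f^*:C(Y)\to C(X)$, $f^*(\varphi)=\varphi\circ f$, and $f^{**}:\mathbb R^{C(X)}\to\mathbb R^{C(Y)}$, $f^{**}(\mu)(\varphi)=\mu(\varphi\circ f)$; this makes $\mathbb R^{C(\cdot)}$ a covariant functor to Tychonoff spaces. For $x\in X$, $\delta_X(x)\in\mathbb R^{C(X)}$ is the functional $\varphi\mapsto\varphi(x)$. A functional functor is a functor $F:\mathsf{Comp}\to\mathsf{Comp}$ which is a subfunctor of $\mathbb R^{C(\cdot)}$ (so $FX\subset\mathbb R^{C(X)}$ is a compact subspace for each $X$, and $Ff=f^{**}|FX$ maps $FX$ into $FY$) and such that $\delta_X(x)\in FX$ for every compact $X$ and $x\in X$. An operator $u:C(X)\to C(Y)$ is any function (not necessarily linear or continuous). It is $F$-regular if for every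 $y\in Y$ the functional $\varphi\mapsto u(\varphi)(y)$ on $C(X)$ belongs to $FX$. For a surjective map $f:X\to Y$, an averaging operator for $f$ is an operator $u:C(X)\to C(Y)$ with $u\circ f^*=\mathrm{id}_{C(Y)}$; for an injective map $f:X\to Y$, an extension operator for $f$ is an operator $u:C(X)\to C(Y)$ with $f^*\circ u=\mathrm{id}_{C(X)}$. $X$ is $F$-Milutin if there is a continuous surjective map $f:K\to X$ from a Cantor cube $K=\{0,1\}^\kappa$ ($\kappa$ a cardinal) admitting an $F$-regular averaging operator $u:C(K)\to C(X)$. $X$ is $F$-Dugundji if there is a continuous injective map $f:X\to K$ into a Tychonoff cube $K=[0,1]^\kappa$ admitting an $F$-regular extension operator $u:C(X)\to C(K)$. For a closed subset $A\subset X$ with inclusion $i_A^X:A\to X$, ''$a\in FA\subset FX$'' means $a\in Fi_A^X(FA)$. $X$ is an absolute $F$-valued retract if for any embedding $X\subset Y$ into a compact Hausdorff space $Y$ there is a continuous map $r:Y\to FX$ such that $r(x)\in F(\{x\})\subset FX$ for every $x\in X$. $X$ is absolute $F$-Milutin if there are a continuous surjective map $f:K\to X$ from a Cantor cube $K=\{0,1\}^\kappa$ and a continuous map $s:X\to FK$ such that $s(x)\in F(f^{-1}(x))\subset FK$ for all $x\in X$. $F$ preserves preimages over points if for any continuous surjective map $f:X\to Y$ between compact Hausdorff spaces and any one-point set $A\subset Y$, $(Ff)^{-1}(Fi_A^Y(FA))=Fi_{f^{-1}(A)}^X(F(f^{-1}(A)))$. *)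

(* Defs.v *)
From HB Require Import structures.
From mathcomp Require Import all_boot all_order all_algebra.
From mathcomp Require Import all_classical all_reals all_analysis.

Set Implicit Arguments.
Unset Strict Implicit.
Unset Printing Implicit Defensive.

Import Order.TTheory GRing.Theory Num.Theory.
Import numFieldNormedType.Exports.

Local Open Scope classical_set_scope.
Local Open Scope ring_scope.

(* The empty space is allowed. *)
Record compHaus := CompHaus {
  comp_space :> topologicalType;
  comp_compact : compact [set: comp_space];
  comp_hausdorff : hausdorff_space comp_space
}.

Lemma set_val_continuous (X : topologicalType) (A : set X) :
  continuous (@set_val X A).
Proof. exact: initial_continuous. Qed.

Definition incl (X : topologicalType) (A : set X) : continuousType A X :=
  mkcts (@set_val_continuous X A).

Lemma set_type_compact (X : topologicalType) (A : set X) :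
  compact A -> compact [set: A].
Proof.
move=> cA G PG _.
have [|x [Ax clx]] := cA (set_val @ G) (fmap_proper_filter _ PG).
  by apply: (@filterS _ G _ setT) => [a _|]; [exact: set_valP|exact: filterT].
exists (SigSub (mem_set Ax)); split => // B C GB [_ [[D oD <-] Dx] DC].
have GvB : (set_val @ G) (@set_val X A @` B).
  by apply: (@filterS _ G _ B) => // b Bb; exists b.
have nD : nbhs x D by apply: open_nbhs_nbhs; split.
have [_ [[b Bb <-] Db]] := clx _ _ GvB nD.
by exists b; split => //; exact: DC. Qed.

Lemma set_type_hausdorff (X : topologicalType) (A : set X) :
  hausdorff_space X -> hausdorff_space A.
Proof.
move=> hX a b clab; apply: val_inj; apply: hX => B C nB nC.
have [c [Bc Cc]] := clab _ _ (@set_val_continuous X A a B nB)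
                             (@set_val_continuous X A b C nC).
by exists (set_val c).
Qed.

Definition comp_sub (X : compHaus) (A : set X) (clA : closed A) : compHaus :=
  CompHaus
    (set_type_compact (subclosed_compact clA (@comp_compact X) (@subsetT _ A)))
    (set_type_hausdorff (@comp_hausdorff X)).

Lemma closed_point (X : compHaus) (x : X) : closed [set x].
Proof. exact/accessible_closed_set1/hausdorff_accessible/comp_hausdorff. Qed.
Arguments closed_point {X} x.

Lemma closed_fiber (X Y : compHaus) (f : continuousType X Y) (y : Y) :
  closed (f @^-1` [set y]).
Proof.
by apply: preimage_closed; [move=> x _; exact: cts_fun|exact: closed_point].
Qed.
Arguments closed_fiber {X Y} f y.

Lemma prod_compact (I : Type) (K : topologicalType) :
  compact [set: K] -> compact [set: {ptws I -> K}].
Proof.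
move=> cK; have := @tychonoff {classic I} (fun=> K) (fun=> setT) (fun=> cK).
by congr compact; rewrite eqEsubset.
Qed.

Lemma prod_hausdorff (I : Type) (K : topologicalType) :
  hausdorff_space K -> hausdorff_space {ptws I -> K}.
Proof. by move=> hK; exact: (@hausdorff_product {classic I} (fun=> K)). Qed.

(* Cardinals are represented by arbitrary index types. *)
Definition cantor_cube (I : Type) : compHaus :=
  CompHaus (@prod_compact I bool bool_compact)
           (@prod_hausdorff I bool discrete_hausdorff).

Definition tychonoff_cube (R : realType) (I : Type) : compHaus :=
  CompHaus
    (@prod_compact I `[0 : R, 1]%classic
       (set_type_compact (@segment_compact R 0 1)))
    (@prod_hausdorff I `[0 : R, 1]%classic
       (set_type_hausdorff (@Rhausdorff R))).

(* A homeomorphism onto its image. *)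
Definition embedding (X Y : topologicalType) (e : X -> Y) : Prop :=
  injective e /\ (forall U : set X, open U <-> exists2 V, open V & U = e @^-1` V).

Definition surjective (X Y : Type) (f : X -> Y) : Prop :=
  set_surj [set: X] [set: Y] f.

Definition Cfun (R : realType) (X : topologicalType) : Type := continuousType X R.

Definition RCfun (R : realType) (X : topologicalType) : topologicalType :=
  {ptws Cfun R X -> R}.

Definition pullback (R : realType) (X Y : topologicalType)
    (f : continuousType X Y) : Cfun R Y -> Cfun R X :=
  fun phi => phi \o f : continuousType X R.

(* The map f** of R^C(X) into R^C(Y). *)
Definition functional_map (R : realType) (X Y : topologicalType)
    (f : continuousType X Y) : RCfun R X -> RCfun R Y :=
  fun mu phi => mu (pullback f phi).

Definition delta (R : realType) (X : topologicalType) (x : X) : RCfun R X :=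
  fun phi => phi x.

(* With implicit arguments set, X would become implicit in [ff_obj X]. *)
Unset Implicit Arguments.

(* Being a subfunctor of [RCfun R] determines the action of F on morphisms, and
   the functor laws follow from those of [functional_map]. *)
Record functionalFunctor (R : realType) := FunctionalFunctor {
  ff_obj :> forall X : compHaus, set (RCfun R X);
  ff_compact : forall X : compHaus, compact (ff_obj X);
  ff_map : forall (X Y : compHaus) (f : continuousType X Y),
    functional_map f @` ff_obj X `<=` ff_obj Y;
  ff_delta : forall (X : compHaus) (x : X), ff_obj X (delta x)
}.

Set Implicit Arguments.

(* [F A] seen inside [F X]. *)
Definition ff_sub (R : realType) (F : functionalFunctor R) (X : compHaus)
    (A : set X) (clA : closed A) : set (RCfun R X) :=
  functional_map (incl A : continuousType (comp_sub clA) X)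
    @` F (comp_sub clA).

Definition preserves_singletons (R : realType) (F : functionalFunctor R) :=
  forall X : compHaus,
    (exists x : X, [set: X] = [set x]) ->
    exists mu : RCfun R X, F X = [set mu].

Definition preserves_point_preimages (R : realType)
    (F : functionalFunctor R) :=
  forall (X Y : compHaus) (f : continuousType X Y) (y : Y), surjective f ->
    F X `&` functional_map f @^-1` ff_sub F (closed_point y) =
    ff_sub F (closed_fiber f y).

Definition regular_operator (R : realType) (F : functionalFunctor R)
    (X Y : compHaus) (u : Cfun R X -> Cfun R Y) :=
  forall y : Y, F X (fun phi => u phi y).

Definition averaging_operator (R : realType) (X Y : compHaus)
    (f : continuousType X Y) (u : Cfun R X -> Cfun R Y) :=
  u \o pullback f = id.

Definition extension_operator (R : realType) (X Y : compHaus)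
    (f : continuousType X Y) (u : Cfun R X -> Cfun R Y) :=
  pullback f \o u = id.

Definition Milutin (R : realType) (F : functionalFunctor R) (X : compHaus) :=
  exists (I : Type) (f : continuousType (cantor_cube I) X), surjective f /\
  exists u : Cfun R (cantor_cube I) -> Cfun R X,
    regular_operator F u /\ averaging_operator f u.

Definition Dugundji (R : realType) (F : functionalFunctor R) (X : compHaus) :=
  exists (I : Type) (f : continuousType X (tychonoff_cube R I)), injective f /\
  exists u : Cfun R X -> Cfun R (tychonoff_cube R I),
    regular_operator F u /\ extension_operator f u.

Definition absolute_valued_retract (R : realType) (F : functionalFunctor R)
    (X : compHaus) :=
  forall (Y : compHaus) (e : X -> Y), embedding e ->
  exists r : continuousType Y (F X),
    forall x : X, ff_sub F (closed_point x) (set_val (r (e x))).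

Definition absolute_Milutin (R : realType) (F : functionalFunctor R)
    (X : compHaus) :=
  exists (I : Type) (f : continuousType (cantor_cube I) X), surjective f /\
  exists s : continuousType X (F (cantor_cube I)),
    forall x : X, ff_sub F (closed_fiber f x) (set_val (s x)).

(* Main.v *)
(* The formula [u phi y = r y phi] identifies F-regular operators [u] from C(X)
   to C(Y) with continuous maps [r] from Y to FX.  Since F preserves singletons,
   F({x}) is reduced to the Dirac functional at x, so that the extension and
   averaging identities for [u] are the pointwise conditions on [r].  Valued
   retracts on an arbitrary Y are pulled back from a Tychonoff cube along a
   Tietze extension; conversely X embeds in a Tychonoff cube. *)
Require Import Defs.
From mathcomp Require Import all_boot all_order all_algebra.
From mathcomp Require Import all_classical all_reals all_analysis.

Set Implicit Arguments.
Unset Strict Implicit.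
Unset Printing Implicit Defensive.

Import Order.TTheory GRing.Theory Num.Theory.
Import numFieldNormedType.Exports.

Local Open Scope classical_set_scope.
Local Open Scope ring_scope.

Lemma ptws_continuous (T : topologicalType) (I : Type) (K : topologicalType)
    (f : T -> {ptws I -> K}) :
  (forall i, continuous (f^~ i)) -> continuous f.
Proof.
move=> cf x; apply/cvg_sup => i U [_ [[W oW <-]] /= Wfx WU].
apply: filterS WU _; apply: (cf i x).
exact: open_nbhs_nbhs.
Qed.

Lemma ptws_eval_continuous (I : Type) (K : topologicalType) (i : I) :
  continuous (fun g : {ptws I -> K} => g i).
Proof. exact: (@proj_continuous {classic I} (fun=> K) i). Qed.

Lemma set_type_continuous (T Y : topologicalType) (A : set Y) (f : T -> A) :
  continuous (set_val \o f) -> continuous f.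
Proof. exact: continuous_comp_initial. Qed.

Lemma compHaus_normal (X : compHaus) : normal_space X.
Proof. exact: compact_normal (@comp_hausdorff X) (@comp_compact X). Qed.

Lemma injective_embedding (X Y : compHaus) (e : X -> Y) :
  injective e -> continuous e -> embedding e.
Proof.
move=> ie ce; split=> // U; split=> [oU|[V oV ->]]; last first.
  by move/continuousP : ce; apply.
have cl : closed (e @` ~` U).
  apply: compact_closed; first exact: comp_hausdorff.
  apply: continuous_compact; first exact: continuous_subspaceT.
  apply: subclosed_compact (@comp_compact X) _ => //.
  exact: open_closedC.
exists (~` (e @` ~` U)); first exact: closed_openC.
apply/seteqP; split=> x /= => [Ux [z nUz /ie zx]|nx].
  by apply: nUz; rewrite zx.
by apply: contrapT => nUx; apply: nx; exists x.
Qed.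

(** Tietze's theorem on the closed set [range e] of the normal space Y, followed by clipping to the
    unit interval. *)
Lemma embedding_extension (R : realType) (X Y : compHaus) (e : X -> Y)
    (f : X -> `[0 : R, 1]%classic) : embedding e -> continuous f ->
  exists2 g : Y -> `[0 : R, 1]%classic, continuous g & forall x, g (e x) = f x.
Proof.
move=> [ie oe] cf.
have cvf : continuous (set_val \o f : X -> R).
  by move=> x; apply: continuous_comp; [exact: cf|exact: set_val_continuous].
have ce : continuous e by apply/continuousP => V oV; apply/oe; exists V.
have clA : closed (range e).
  apply: compact_closed; first exact: comp_hausdorff.
  by apply: continuous_compact; [exact: continuous_subspaceT|exact: comp_compact].
(* [h] transports [f] to [range e]; the default 0 is arbitrary, since [h] is only used on the
   range. *)
pose h (y : Y) : R := if pselect (exists x, e x = y) is left p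
  then set_val (f (projT1 (cid p))) else 0.
have hE x : h (e x) = set_val (f x).
  rewrite /h; case: pselect => [p|[]]; last by exists x.
  by case: cid => z /= /ie ->.
have hb y : range e y -> `|h y| <= 1.
  move=> [x _ <-]; rewrite hE; have := set_valP (f x).
  by rewrite /= in_itv/= => /andP[f0 f1]; rewrite ger0_norm.
have ch : {within range e, continuous h}.
  apply/subspace_continuousP => _ [x _ <-] W hW.
have nW : nbhs (set_val (f x)) W by rewrite -hE.
  have : nbhs x ((set_val \o f) @^-1` W) by exact: cvf.
  (* Since [e] is an embedding, [U] is the trace of an open [V] of Y, which serves as the
     neighbourhood of [e x]. *)
  rewrite nbhsE => -[U [/oe[V oV UV] Ux] UW].
  have : nbhs (e x) V.
    by apply: open_nbhs_nbhs; split=> //; move: Ux; rewrite UV.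
  apply: filterS => _ /[swap] -[z _ <-] Vz.
  by change (W (h (e z))); rewrite hE; apply: UW; rewrite UV.
have [g [gh cg gb]] :=
  continuous_bounded_extension (@compHaus_normal Y) clA ltr01 ch hb.
(* Tietze only gives [|g| <= 1]. Cutting off the negative part changes nothing on the range, where
   [f] is nonnegative. *)
have g01 y : `[0 : R, 1]%classic (Num.max 0 (g y)).
  rewrite /= in_itv/= le_max lexx/= ge_max ler01/=.
  exact: le_trans (ler_norm _) (gb y).
exists (fun y => SigSub (mem_set (g01 y))) => [|x].
  apply: set_type_continuous => y.
  apply: (@continuous_max R Y (fun=> 0) g); [exact: cvg_cst|exact: cg].
apply: val_inj => /=; rewrite -gh ?hE; last by apply/mem_set; exists x.
have := set_valP (f x); rewrite /= in_itv/= => /andP[f0 _].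
exact/max_idPr.
Qed.

Lemma compHaus_separate (R : realType) (X : compHaus) (x y : X) : x <> y ->
  exists2 f : X -> `[0 : R, 1]%classic, continuous f & f x <> f y.
Proof.
move=> xy.
have xy0 : [set x] `&` [set y] = set0.
  by apply/seteqP; split=> z //= -[-> /xy].
have [f [cf fx fy f01]] := urysohn_ext_itv (@compHaus_normal X)
  (closed_point x) (closed_point y) xy0 (@ltr01 R).
exists (fun z => SigSub (mem_set (f01 _ (imageP f (I : setT z))))).
  exact: set_type_continuous.
move=> /(congr1 set_val) fxy; have {fxy} : f x = f y := fxy.
rewrite (fx _ (imageP f (erefl x))) (fy _ (imageP f (erefl y))) => /eqP.
by rewrite eq_sym oner_eq0.
Qed.

Section canonical_embedding.
Variables (R : realType) (X : compHaus).

Definition canonical_map (x : X) :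
    tychonoff_cube R (continuousType X `[0 : R, 1]%classic) :=
  fun f => f x.

Lemma canonical_map_continuous : continuous canonical_map.
Proof. by apply: ptws_continuous => f; exact: cts_fun. Qed.

Lemma canonical_map_injective : injective canonical_map.
Proof.
move=> x y xy; apply: contrapT => /(@compHaus_separate R)[f cf]; apply.
pose i : continuousType X `[0 : R, 1]%classic := mkcts cf.
by have := congr1 (fun g : {ptws _ -> _} => g i) xy.
Qed.

Lemma canonical_map_embedding : embedding canonical_map.
Proof.
exact: injective_embedding canonical_map_injective canonical_map_continuous.
Qed.

End canonical_embedding.

Section functional_functor.
Variables (R : realType) (F : functionalFunctor R).

Definition operator_of (X Y : compHaus) (r : continuousType Y (F X)) :
    Cfun R X -> Cfun R Y :=
  fun phi => mkcts (fun y => continuous_comp (@cts_fun _ _ r y)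
    (continuous_comp (@set_val_continuous _ (F X) (r y))
      (@ptws_eval_continuous _ _ phi (set_val (r y))))).

Lemma operator_of_regular (X Y : compHaus) (r : continuousType Y (F X)) :
  regular_operator F (operator_of r).
Proof. by move=> y; exact: set_valP (r y). Qed.

(** Continuity is checked at each [phi], by the product topology. The map [g] will be a Tietze
    extension for retracts and the identity for Milutin spaces. *)
Lemma regular_operator_map (X Y Z : compHaus) (u : Cfun R X -> Cfun R Y)
    (g : Z -> Y) : regular_operator F u -> continuous g ->
  exists r : continuousType Z (F X),
    forall z, set_val (r z) = (fun phi => u phi (g z)).
Proof.
move=> Fu cg; pose r z : F X := SigSub (mem_set (Fu (g z))).
have cr : continuous r.
  apply: set_type_continuous; apply: ptws_continuous => phi z.
  apply: continuous_comp; [exact: cg|exact: cts_fun].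
by exists (mkcts cr).
Qed.

Lemma delta_ff_sub (X : compHaus) (x : X) : ff_sub F (closed_point x) (delta x).
Proof.
pose pt : comp_sub (closed_point x) := SigSub (mem_set (erefl x : [set x] x)).
exists (delta pt) => //.
exact: ff_delta.
Qed.

Hypothesis F1 : preserves_singletons F.

Lemma ff_singleton (X : compHaus) (x : X) (mu : RCfun R X) :
  [set: X] = [set x] -> F X mu -> mu = delta x.
Proof.
move=> Xx; have [|nu FX] := F1 (X := X); first by exists x.
by move: (ff_delta _ F _ x); rewrite FX => -> ->.
Qed.

(** On A the map [f] factors through the constant map to the singleton of [y], and the only element
    of F there is the Dirac functional. *)
Lemma ff_sub_fiber (X Y : compHaus) (f : continuousType X Y) (y : Y)
    (A : set X) (clA : closed A) (mu : RCfun R X) :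
  A `<=` f @^-1` [set y] -> ff_sub F clA mu -> functional_map f mu = delta y.
Proof.
move=> Ay [nu Fnu <-]; apply/funext => phi.
pose pt : comp_sub (closed_point y) := SigSub (mem_set (erefl y : [set y] y)).
pose c : continuousType (comp_sub clA) (comp_sub (closed_point y)) := cst pt.
have ptT : [set: comp_sub (closed_point y)] = [set pt].
  by apply/seteqP; split=> // z _; apply: val_inj; exact: set_valP z.
have /(ff_singleton ptT) := ff_map _ F _ _ c _ (imageP (functional_map c) Fnu).
(* Evaluate at the restriction of [phi] to the point; pulled back along [c], it coincides with
   [phi \o f] on A. *)
move=> /(congr1 (@^~ (pullback (Defs.incl [set y]) phi))).
rewrite /delta /functional_map /= => <-; congr nu.
apply/continuousEP => z /=.
by have /= -> := Ay _ (set_valP z).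
Qed.

Lemma ff_sub_point (X : compHaus) (x : X) (mu : RCfun R X) :
  ff_sub F (closed_point x) mu -> mu = delta x.
Proof.
move=> Fmu; rewrite -(@ff_sub_fiber _ _ idfun x _ (closed_point x) mu)//.
by apply/funext => phi; congr mu; apply/continuousEP.
Qed.

End functional_functor.

Theorem corollary3p2 (R : realType) (F : functionalFunctor R)
    (F1 : preserves_singletons F) (X : compHaus) :
  (Dugundji F X <-> absolute_valued_retract F X) /\
  (absolute_Milutin F X -> Milutin F X) /\
  (preserves_point_preimages F -> (Milutin F X <-> absolute_Milutin F X)).
Proof.
have MX : absolute_Milutin F X -> Milutin F X.
  move=> [I [f [sf [s sE]]]]; exists I, f; split=> //.
  exists (operator_of s); split; first exact: operator_of_regular.
  apply/funext => phi; apply/continuousEP => x.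
  exact: (congr1 (@^~ phi) (ff_sub_fiber F1 (@subset_refl _ _) (sE x))).
split; [split|split=> // Fpre; split=> //].
- move=> [I [f [injf [u [Fu uE]]]]] Y e emb_e.
  have pf (i : I) : exists g : Y -> `[0 : R, 1]%classic,
      continuous g /\ forall x, g (e x) = f x i.
    have cfi : continuous (fun x => f x i).
      move=> x; apply: (@continuous_comp _ _ _ f (fun h : {ptws _ -> _} => h i)).
        exact: cts_fun.
      exact: ptws_eval_continuous.
    by have [g cg gE] := embedding_extension emb_e cfi; exists g.
  have [g gP] := choice pf.
  (* The coordinatewise extensions assemble into a map from Y to the cube with [h \o e = f]. *)
  pose h (y : Y) : tychonoff_cube R I := fun i => g i y.
  have [|r rE] := regular_operator_map (g := h) Fu.
    by apply: ptws_continuous => i; case: (gP i).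
  exists r => x; rewrite rE.
  have -> : h (e x) = f x.
    by apply/funext => i; exact: (gP i).2.
  suff -> : (fun phi => u phi (f x)) = delta x by exact: delta_ff_sub.
  apply/funext => phi.
  by have /continuousEP/(_ x) := congr1 (@^~ phi) uE.
- move=> XF; have [r rE] := XF _ _ (@canonical_map_embedding R X).
  exists _, (mkcts (@canonical_map_continuous R X)).
  split; first exact: canonical_map_injective.
  exists (operator_of r); split; first exact: operator_of_regular.
  apply/funext => phi; apply/continuousEP => x.
  exact: (congr1 (@^~ phi) (ff_sub_point F1 (rE x))).
- move=> [I [f [sf [u [Fu uE]]]]]; exists I, f; split=> //.
  have [|s sE] := regular_operator_map (g := id) Fu; first by move=> x.
  (* Preservation of point preimages reduces support in the fiber to a condition on the image under
     [functional_map f], which the averaging identity shows to be [delta x]. *)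
  exists s => x; rewrite -Fpre//; split; first exact: set_valP (s x).
  rewrite /= sE.
  suff -> : functional_map f (fun phi => u phi x) = delta x.
    exact: delta_ff_sub.
  apply/funext => phi.
  by have /continuousEP/(_ x) := congr1 (@^~ phi) uE.
Qed.
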